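(* Up to isomorphism there is exactly one abstract regular polytope of rank $r\in\{4,5\}$ whose automorphism group is isomorphic to a transitive group of even permutations of degree $11$, namely the $11$-cell, which has rank $4$ and is self-dual. Equivalently: there is, up to isomorphism of string C-groups, exactly one string C-group $(G,\{\rho_0,\ldots,\rho_{r-1}\})$ with $r\in\{4,5\}$ such that $G$ is isomorphic to a transitive subgroup of the alternating group $A_{11}$ (acting on $11$ points); it has rank $r=4$, it is the string C-group of the $11$-cell, and it is isomorphic to its dual.
   Context: A string group generated by involutions (sggi) of rank $r$ is a pair $\Gamma=(G,\{\rho_0,\ldots,\rho_{r-1}\})$ where $G$ is a group generated by the ordered set of involutions $\{\rho_0,\ldots,\rho_{r-1}\}$ and $(\rho_i\rho_j)^2=1$ whenever $|i-j|>1$. It is a string C-group if moreover it satisfies the intersection property: $\langle \rho_j\mid j\in J\rangle\cap\langle\rho_k\mid k\in K\rangle=\langle\rho_j\mid j\in J\cap K\rangle$ for all $J,K\subseteq\{0,\ldots,r-1\}$. Abstract regular polytopes of rank $r$ with automorphism group $G$ are in one-to-one correspondence (up to isomorphism) with string C-groups $(G,\{\rho_0,\ldots,\rho_{r-1}\})$. Two sggi's $(G,\{\rho_i\})$ and $(H,\{\sigma_i\})$ of the same rank are isomorphic if there is a group isomorphism $G\to H$ with $\rho_i\mapsto\sigma_i$ for all $i$. The dual of an sggi is obtained by reversing the order of its generators; it is self-dual if it is isomorphic to its dual. The $11$-cell is the abstract regular $4$-polytope of type $\{3,5,3\}$ (with hemi-icosahedral facets and hemi-dodecahedral vertex-figures)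 with automorphism group $\mathrm{PSL}_2(11)$. Its string C-group is given by $\langle\rho_0,\rho_1,\rho_2,\rho_3\mid \rho_i^2=(\rho_0\rho_1)^3=(\rho_1\rho_2)^5=(\rho_2\rho_3)^3=(\rho_0\rho_2)^2=(\rho_0\rho_3)^2=(\rho_1\rho_3)^2=(\rho_0\rho_1\rho_2)^5=(\rho_1\rho_2\rho_3)^5=1\rangle$. *)

(* Defs.v *)
From HB Require Import structures.
From mathcomp Require Import all_boot all_fingroup all_solvable.

Set Implicit Arguments.
Unset Strict Implicit.
Unset Printing Implicit Defensive.

Local Open Scope group_scope.

(* A finite group with an ordered tuple of elements. Only finite groups are    *)
(* considered: a group isomorphic to a permutation group of degree 11 is       *)
(* finite.                                                                     *)
Record group_with_gens := GroupWithGens {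
  sgrank : nat;
  carrier : finGroupType;
  grp : {group carrier};
  gens : sgrank.-tuple carrier
}.

Definition rho (Gamma : group_with_gens) (i : 'I_(sgrank Gamma)) :
  carrier Gamma := tnth (gens Gamma) i.

Definition gen_sub (Gamma : group_with_gens) (J : {set 'I_(sgrank Gamma)}) :
  {set carrier Gamma} := <<[set rho j | j in J]>>.

Definition is_sggi (Gamma : group_with_gens) : Prop :=
  [/\ gen_sub [set: 'I_(sgrank Gamma)] = grp Gamma,
      forall i, #[@rho Gamma i] = 2
    & forall i j : 'I_(sgrank Gamma),
        (i.+1 < j) || (j.+1 < i) -> (rho i * rho j) ^+ 2 = 1].

Definition is_string_C_group (Gamma : group_with_gens) : Prop :=
  is_sggi Gamma /\
  forall J K : {set 'I_(sgrank Gamma)},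
    gen_sub J :&: gen_sub K = gen_sub (J :&: K).

(* Equality of the underlying sequences forces the ranks to be equal. *)
Definition string_iso (Gamma Delta : group_with_gens) : Prop :=
  exists f : {morphism grp Gamma >-> carrier Delta},
    isom (grp Gamma) (grp Delta) f /\
    map f (gens Gamma) = gens Delta :> seq (carrier Delta).

Definition string_dual (Gamma : group_with_gens) : group_with_gens :=
  GroupWithGens (grp Gamma) [tuple of rev (gens Gamma)].

Definition self_dual (Gamma : group_with_gens) : Prop :=
  string_iso Gamma (string_dual Gamma).

Definition iso_transitive_even (n : nat) (gT : finGroupType)
    (G : {group gT}) : Prop :=
  exists H : {group 'S_n},
    [/\ H \subset 'Alt_('I_n), [transitive H, on [set: 'I_n] | 'P]
      & G \isog H].

Definition eleven_cell_relations (H : groupType) (r0 r1 r2 r3 : H) : Prop :=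
  [/\ [/\ r0 ^+ 2 = 1, r1 ^+ 2 = 1, r2 ^+ 2 = 1 & r3 ^+ 2 = 1],
      [/\ (r0 * r1) ^+ 3 = 1, (r1 * r2) ^+ 5 = 1 & (r2 * r3) ^+ 3 = 1],
      [/\ (r0 * r2) ^+ 2 = 1, (r0 * r3) ^+ 2 = 1 & (r1 * r3) ^+ 2 = 1]
    & (r0 * r1 * r2) ^+ 5 = 1 /\ (r1 * r2 * r3) ^+ 5 = 1].

(* Gamma is the group presented by the relations of the 11-cell, with its     *)
(* generators in order: they generate, satisfy the relations, and are         *)
(* universal for this among all groups, finite or not.                        *)
Definition is_eleven_cell (Gamma : group_with_gens) : Prop :=
  exists r0 r1 r2 r3 : carrier Gamma,
    [/\ gens Gamma = [:: r0; r1; r2; r3] :> seq (carrier Gamma),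
        gen_sub [set: 'I_(sgrank Gamma)] = grp Gamma,
        eleven_cell_relations r0 r1 r2 r3
      & forall (H : groupType) (x0 x1 x2 x3 : H),
          eleven_cell_relations x0 x1 x2 x3 ->
          exists phi : carrier Gamma -> H,
            {in grp Gamma &, {morph phi : x y / x * y}} /\
            [/\ phi r0 = x0, phi r1 = x1, phi r2 = x2 & phi r3 = x3]].

(* Main.v *)
(* A string C-group as in the theorem gives a tuple of even involutions of 11
   points, generating a transitive group, in which non-adjacent generators
   commute.  Up to renaming the points there are 244 such tuples of rank 4 and 28
   of rank 5, and a search over partial action tables, in the style of the
   low-index subgroups algorithm, runs through all of them.  All but two violate
   the intersection property, as witnessed by an element that has a word in one
   set of generators and a word in another, but none in the common generators.
   The two survivors satisfy the relations of the 11-cell; they correspond to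
   the two classes of degree-11 actions of PSL(2,11).
     The relations present a group of order 660: coset enumeration over the
   trivial subgroup reduces every word, in any group satisfying the relations,
   to one of 660 words.  If the 659 nonempty ones are moreover nontrivial in two
   such groups, the same words are trivial in both, so they are isomorphic as
   groups with generators.  This yields uniqueness, the universal property of the
   11-cell, and its self-duality. *)
From Stdlib Require Import Ascii String.
Require Import Defs.
From mathcomp Require Import all_boot all_fingroup all_solvable.

Set Implicit Arguments.
Unset Strict Implicit.
Unset Printing Implicit Defensive.

Local Open Scope nat_scope.

(** * Partial action tables *)

(* Unlike [has], [find] stops at the first hit under call-by-value. *)
Definition lazy_has T (a : pred T) (s : seq T) := find a s < size s.

Lemma lazy_hasE T (a : pred T) (s : seq T) : lazy_has a s = has a s.
Proof. by rewrite has_find. Qed.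

(* In a table, [entry K i v = Some w] records that generator [i] maps the point
   named [v] to the point named [w]; [None] means not yet determined. *)
Definition table := seq (seq (option nat)).

Definition entry (K : table) (i v : nat) : option nat :=
  nth None (nth [::] K i) v.

Definition put (K : table) (i v w : nat) : table :=
  set_nth [::] K i (set_nth None (nth [::] K i) v (Some w)).

Definition link (K : table) (i v w : nat) : table := put (put K i v w) i w v.

Definition run T (act : nat -> T -> T) (t : T) (w : seq nat) : T :=
  foldl (fun t i => act i t) t w.

Fixpoint walk (K : table) (v : nat) (w : seq nat) : option nat :=
  if w is i :: w' then
    if entry K i v is Some u then walk K u w' else None
  else Some v.

(** A rule [(i, w)] asserts that generator [i] acts as the word [w]. *)
Definition deduce (v : nat) (K : table) (rule : nat * seq nat) : table :=
  if entry K rule.1 v is None then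
    if walk K v rule.2 is Some u then link K rule.1 v u else K
  else K.

Definition close (rules : seq (nat * seq nat)) (n : nat) (K : table) : table :=
  foldl (fun K v => foldl (deduce v) K rules) K (iota 0 n).

(* An even involution of 11 points other than 1 has 2 or 4 transpositions, so
   it fixes 7 or 3 points. *)
Definition overfull (row : seq (option nat)) : bool :=
  let s := zip row (iota 0 11) in
  let f := count (fun p => if p.1 is Some w then w == p.2 else false) s in
  let m := count (fun p => if p.1 is Some w then w != p.2 else false) s in
  (* More than 3 fixed points means 7 of them, which leaves 4 moved points; otherwise up to 8 points
     may be moved. *)
  if 3 < f then (if 7 < f then true else 4 < m) else 8 < m.

Definition far (i j : nat) : bool := (i.+1 < j) || (j.+1 < i).

(** Commuting involutions [i] and [j] act on [v], [w] and their [j]-images as on a square with equal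
    labels on opposite sides. The new side from [v] to [w] and two more known sides force the
    fourth. A triple [(k, a, b)] asks that [k] map [a] to [b]. *)
Definition squares (r : nat) (K : table) (i v w : nat) : seq (nat * nat * nat) :=
  flatten [seq
    if far i j then
      let a := entry K j v in
      let b := entry K j w in
      let one x f := if x is Some y then f y else [::] in
      one a (fun a' => one b (fun b' => [:: (i, a', b')])) ++
      one a (fun a' => one (entry K i a') (fun c => [:: (j, w, c)])) ++
      one b (fun b' => one (entry K i b') (fun c => [:: (j, v, c)]))
    else [::] | j <- iota 0 r].

(** [None] signals a contradiction. Exhausted fuel merely drops pending deductions, which weakens
    the pruning but remains sound. *)
Fixpoint propagate (r fuel : nat) (K : table) (q : seq (nat * nat * nat)) :
    option table :=
  if fuel is fuel'.+1 then
    if q is (i, v, w) :: q' then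
      match entry K i v, entry K i w with
      | Some a, _ => if a == w then propagate r fuel' K q' else None
      | None, Some b => if b == v then propagate r fuel' K q' else None
      | None, None =>
          let K' := link K i v w in
          if overfull (nth [::] K' i) then None else
          propagate r fuel' K' (squares r K' i v w ++ q')
      end
    else Some K
  else Some K.

Definition cells (order : seq nat) (n : nat) : seq (nat * nat) :=
  [seq (i, v) | v <- iota 0 n, i <- order].

(* Points are named in the order in which they are discovered from the point 0,
   so an undetermined entry is either an old name or the next unused one. *)
Fixpoint search (r : nat) (order : seq nat) (leaf : pred table) (fuel : nat)
    (K : table) (n : nat) : bool :=
  if fuel is fuel'.+1 then
    let c := cells order n in
    let k := find (fun c => ~~ entry K c.1 c.2) c in
    (* All entries at the known points are determined, so these points form an invariant set; fewer
       than 11 of them contradict transitivity. *)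
    if k == size c then (if n < 11 then true else leaf K) else
    let: (i, v) := nth (0, 0) c k in
    all (fun w =>
      if propagate r 100 K [:: (i, v, w)] is Some K' then
        search r order leaf fuel' K' (maxn n w.+1)
      else true)
     (iota 0 (minn n.+1 11))
  else false.

(** * Leaves of the search *)

(** Breadth-first enumeration of an orbit, each element with a word reaching it. Words extend those
    of the previous layer and so form a spanning tree. Completeness does not rest on the fuel: it is
    checked afterwards, for instance by [stable]. *)
Fixpoint spread (A : eqType) (f : nat -> A -> A) (M : seq nat) (fuel : nat)
    (seen : seq A) (front : seq (seq nat * A)) : seq (seq nat * A) :=
  if fuel is fuel'.+1 then
    let: (seen', new) :=
      foldl (fun st c =>
          if lazy_has (pred1 c.2) st.1 then st else (c.2 :: st.1, c :: st.2))
        (seen, [::]) [seq (rcons c.1 i, f i c.2) | c <- front, i <- M] in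
    front ++ spread f M fuel' seen' (rev new)
  else [::].

Definition orbit_words (A : eqType) (f : nat -> A -> A) (M : seq nat) (a : A) :=
  spread f M 25 [:: a] [:: ([::], a)].

Definition stable (A : eqType) (f : nat -> A -> A) (M : seq nat) (D : seq A) :=
  all (fun a => all (fun i => lazy_has (pred1 (f i a)) D) M) D.

Definition step (K : table) (i : nat) (t : seq nat) : seq nat :=
  [seq odflt 0 (entry K i y) | y <- t].

(** A permutation of the point names in one-line notation. *)
Definition image (K : table) (w : seq nat) : seq nat :=
  run (step K) (iota 0 11) w.

Definition common (u v : seq nat) : seq nat :=
  [seq i <- iota 0 5 | (i \in u) && (i \in v)].

(* The intersection property puts an element with words [c.1] and [c.2] into the
   subgroup generated by the letters that these words share. *)
Definition kills (K : table) (c : seq nat * seq nat) : bool :=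
  if image K c.1 == image K c.2 then
    let M := common c.1 c.2 in
    let D := unzip2 (orbit_words (step K) M (iota 0 11)) in
    (* A stable list containing the identity contains the whole subgroup generated by [M]. *)
    [&& stable (step K) M D, iota 0 11 \in D & image K c.1 \notin D]
  else false.

(** The squares of the generators are missing because [cellular] imposes them separately. *)
Definition cell_relators : seq (seq nat) :=
  [:: [:: 0; 2; 0; 2]; [:: 0; 3; 0; 3]; [:: 1; 3; 1; 3];
      flatten (nseq 3 [:: 0; 1]); flatten (nseq 3 [:: 2; 3]);
      flatten (nseq 5 [:: 1; 2]);
      flatten (nseq 5 [:: 0; 1; 2]); flatten (nseq 5 [:: 1; 2; 3])].

(* The 11-cell group acting on 11 points, one row per generator. *)
Definition cell_rows : seq (seq nat) :=
  [:: [:: 0; 1; 2; 4; 3; 6; 5; 9; 10; 7; 8];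
      [:: 0; 1; 3; 2; 4; 7; 8; 5; 6; 10; 9];
      [:: 0; 2; 1; 5; 6; 3; 4; 7; 10; 9; 8];
      [:: 1; 0; 2; 3; 4; 7; 9; 5; 10; 6; 8]].

Definition cell_table : table := map (map some) cell_rows.

(** One word per group element, the empty word first; positions in this list serve as coset names in
    the coset enumeration. *)
Definition cell_words : seq (seq nat) := Eval vm_compute in
  unzip1 (orbit_words (step cell_table) (iota 0 4) (iota 0 11)).

(* As [cell_words] represent the elements of a group of order 660, the second
   condition says that no nontrivial one of them becomes trivial. *)
Definition is_cell (K : table) : bool :=
  all (fun R => image K R == iota 0 11) cell_relators &&
  all (fun w => image K w != iota 0 11) (behead cell_words).

Definition leaf (r : nat) (certs : seq (seq nat * seq nat)) (K : table) : bool :=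
  if lazy_has (kills K) certs then true else (r == 4) && is_cell K.

Fixpoint word (s : string) : seq nat :=
  (* 48 is the character code of the digit 0. *)
  if s is String c s' then (nat_of_ascii c - 48) :: word s' else [::].

(* One of these pairs of words kills each even transitive table of rank 4 that
   does not satisfy the relations of the 11-cell; they were found by comparing
   short words in the first three and in the last three generators. *)
Definition certificates4 : seq (seq nat * seq nat) := Eval vm_compute in
  [seq (word c.1, word c.2) | c <- [::
    ("0", "232323232323");
    ("01010101010", "13");
    ("0", "23232323232323232323");
    ("10101010101010101010", "3");
    ("20", "32323");
    ("101010", "3");
    ("0101010101010", "13");
    ("20", "3232323232323");
    ("0121210121210", "3212123212123");
    ("12010121012101201", "3232123212323");
    ("01021010210", "1212321323213232121");
    ("212012012012012012010", "32312323232123");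
    ("12101201010101210", "323123123123123123");
    ("0101010", "13");
    ("20", "3232323");
    ("210121012101", "323232323");
    ("210120101201010", "323232323");
    ("012101210", "21213212321213212");
    ("010121010210", "21321321321323");
    ("010210210210", "21323212321323");
    ("01010101021012101210", "323232321");
    ("01010", "232323212323232123232321");
    ("210101012101010121010101", "32323");
    ("010101012", "32323232312321232123");
    ("010121012101010121012101", "232323");
    ("010101", "232123212323232123212323");
    ("101212101212101", "3232312123212312323");
    ("010210101021010210101021", "2323232323");
    ("1210121201012012101", "321212321212312");
    ("0101010101", "213232321323213232321323");
    ("0101212101012101012121010121", "1212132121232121232");
    ("1012121012121021212", "2123232121232321232321212323");
    ("0121210", "32312123123");
    ("01021210210", "3212123");
    ("01010", "21212132321321212");
    ("010121210212121210", "32321321");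
    ("0121210121210", "2321321213232");
    ("01012012", "323212123121212123");
    ("21212010101201212", "323212323");
    ("010102", "21213212123212121321");
    ("010121010", "12121323232132121");
    ("0101021021021010", "3212132123");
    ("12120101010120121", "321232123");
    ("12120121012120121", "323232323");
    ("1012012120101", "3212123212123");
    ("12120121210121212012", "323231");
    ("0121201210", "3232312312312323");
    ("0121210121210", "13212321212323");
    ("0121210121210", "12121323232323");
    ("212012012", "321232123121232123");
    ("012101212012101210", "123123121");
    ("01021012", "3232321232321232323");
    ("21212010101010", "3212123212123");
    ("0101212101210", "32121232121232");
    ("0101012101012101010", "12321323");
    ("210120120", "3232323123232312323");
    ("0120121010101212010", "321232123");
    ("01021210210", "13232132121323213");
    ("012101210", "3231212323232123123");
    ("0101010210101021010", "123213213");
    ("20101201212010120", "32312123123");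
    ("1212121201010101212", "32312312321");
    ("01010121212101010", "3212123212123");
    ("0121210121210", "32323212121232323");
    ("12121212012012010121", "3232323212");
    ("0102121021210", "323232132323213212");
    ("010101201010120121", "3231212312123");
    ("01021010210", "13232121321232121323");
    ("0101210212101210210", "232132321323");
    ("210121212121012", "32123121212312123");
    ("010101021212", "12123213232121212123");
    ("01012121012012012012", "323123123121");
    ("0101012101012121210", "2323232132121");
    ("0121012101210", "2321321321213213232");
    ("01021021210210210", "132123212321213");
    ("0101012101010", "2121213232321232323");
    ("1201210101210101210", "2312121231212");
    ("012012012012121", "32321212323123123");
    ("121201212120121", "32123232123232123");
    ("01210212121021210", "123212121212321");
    ("0101212121210210", "21232321232132132");
    ("101201010120101012010", "323121231231");
    ("0101210102102", "12132321212121213213");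
    ("0102102121210210210", "21321232132123");
    ("12012101201210", "3231231212123123123");
    ("010212102102", "232132323213232321323");
    ("0102121210210", "212123232132123212123");
    ("01010121210121210", "21213213212121323");
    ("0121212121212101", "323231212121212123");
    ("01012121010121", "32121212121212321232");
    ("01212121212121012101", "32321212323212");
    ("2012121212121201010", "321212121212123");
    ("212121201010101010", "32321232321212123");
    ("01212121010121010121", "323232323231212");
    ("10101212012012101012101", "3232312323123");
    ("21010120120121012101", "32321212321232123");
    ("1012101210121010121012101210", "323123212");
    ("21010121210121012120", "32323123121232123");
    ("010210121", "2321232123212323212321232123");
    ("0101201201201201010", "1232123212123212321");
    ("2101210121210121012", "3232312312312312323");
    ("0102102", "21321213213212132132121321321213");
    ("02121021021210210212102102121021", "1321323");
    ("01212102", "323213232323232132323232321323232");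
    ("010102101010101021010101010210101", "32121213");
    ("121210120121", "3212321232123212321232123212321232123212");
    ("1210121012101210121012101210121012101210", "212312321212");
    ("20121212101210", "323121212121212312312312312121323121212121212312312312312121323121212121212312312312312121323121212121212312312312312121");
    ("212121012121012121212121212101212121012121012121212121212101212121012121012121212121212101212121012121012121212121212101", "32312312121231")]%string].

(** In rank 5 every table must be killed. Words in generators 0, 1, 2 are compared with words in 1,
    2, 3, or words in 1, 2, 3 with words in 2, 3, 4. *)
Definition certificates5 : seq (seq nat * seq nat) := Eval vm_compute in
  [seq (word c.1, word c.2) | c <- [::
    ("0", "23232323232323232323");
    ("0", "232323232323");
    ("0", "1232132321212321323212");
    ("12121", "32323243232432432343");
    ("0121021021210", "123213212123");
    ("0", "121321232321213213232323");
    ("010121210212121210", "32321321");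
    ("010212121210", "21212121232323");
    ("12121", "232323232343232323234");
    ("010101010", "21213212321213212");
    ("0102121010101210210", "321232123");
    ("121232121", "3432324323232343234");
    ("0102102121210210210", "323212323");
    ("121212121", "32323243232432432343");
    ("0121021021210", "1232323213212123");
    ("010212121210", "212121212323232323");
    ("121212121", "232323232343232323234");
    ("01212121210", "123212132121213212321");
    ("010210210212", "32321212321321321321");
    ("0102102121210210210", "21232323232132");
    ("121212121", "232343232432323234323243");
    ("01010121210121210", "21213213212121323");
    ("0101021010210", "23232121321321232321232")]%string].

(** * Soundness of the search *)

Lemma entry_put K i v w j u :
  entry (put K i v w) j u =
  if (j == i) && (u == v) then Some w else entry K j u.
Proof.
rewrite /entry /put nth_set_nth /=; case: (j =P i) => [->|_] //=.
by rewrite nth_set_nth /=; case: (u == v).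
Qed.

Section Models.
Variables (T : Type) (act : nat -> T -> T) (val : nat -> T).
Hypothesis actK : forall i, involutive (act i).

(** The acted-on type is arbitrary: it is the set of 11 points in the search, and the group itself
    in the coset enumeration. *)
Definition models (n : nat) (K : table) : Prop :=
  forall i v w, entry K i v = Some w ->
  [/\ v < n, w < n & act i (val v) = val w].

Lemma models_put n K i v w :
  models n K -> v < n -> w < n -> act i (val v) = val w ->
  models n (put K i v w).
Proof.
move=> mK vn wn e j u u'; rewrite entry_put.
by case: andP => [[/eqP-> /eqP->] [<-] | _ /mK].
Qed.

Lemma models_link n K i v w :
  models n K -> v < n -> w < n -> act i (val v) = val w ->
  models n (link K i v w).
Proof.
move=> mK vn wn e; apply: models_put => //; first exact: models_put.
by rewrite -e actK.
Qed.

Lemma models_walk n K v w u : models n K -> v < n -> walk K v w = Some u ->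
  u < n /\ run act (val v) w = val u.
Proof.
move=> mK; elim: w v => [|i w IHw] v vn /=; first by case=> <-.
by case e: entry => [x|] //; case/mK: e => _ xn -> /(IHw _ xn).
Qed.

Lemma models_close n rules K :
  (forall rule t, rule \in rules -> act rule.1 t = run act t rule.2) ->
  models n K -> models n (close rules n K).
Proof.
move=> okr; rewrite /close.
have: {subset iota 0 n <= gtn n} by move=> v; rewrite mem_iota.
elim: (iota 0 n) K => //= v s IHs K sn mK.
apply: IHs => [u us|]; first by apply: sn; rewrite inE us orbT.
have vn: v < n by apply: sn; rewrite mem_head.
elim: rules okr K mK => //= rule l IHl okr K mK.
apply: IHl => [a t al|]; first by apply: okr; rewrite inE al orbT.
rewrite /deduce; case: (entry K rule.1 v) => //.
case e: walk => [u|] //; have [un eu] := models_walk mK vn e.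
by apply: models_link => //; rewrite okr ?mem_head.
Qed.

End Models.

Section Search.
Variables (r : nat) (s : nat -> {perm 'I_11}).
Hypothesis sK : forall i, involutive (s i).
Hypothesis s_far : forall i j, i < r -> j < r -> far i j ->
  forall x, s i (s j x) = s j (s i x).
Hypothesis s_fixes : forall i, i < r ->
  #|[set x | s i x == x]| \in [:: 3; 7].
Hypothesis s_trans : forall A : {set 'I_11}, A != set0 ->
  (forall i x, i < r -> x \in A -> s i x \in A) -> A = setT.

Let act i (x : 'I_11) := s i x.
Let val (p : seq 'I_11) v := nth ord0 p v.

(** Different entries of a row belong to differently named, hence different, points of [A]. *)
Lemma card_bound (p : seq 'I_11) (K : table) i (A : {set 'I_11})
    (a : pred (option nat * nat)) :
  uniq p -> models act (val p) (size p) K ->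
  (forall v w, a (Some w, v) -> v < size p -> s i (val p v) = val p w ->
     w < size p -> val p v \in A) ->
  (forall v, ~~ a (None, v)) ->
  count a (zip (nth [::] K i) (iota 0 11)) <= #|A|.
Proof.
move=> up mK aA aN; set z := zip _ _.
have zP q : q \in filter a z -> q.2 < size p /\ val p q.2 \in A.
  rewrite mem_filter => /andP[aq /(nthP (None, 0))[k kz eq]].
  move: (kz); rewrite size_zip size_iota leq_min => /andP[_ k11].
  move: eq; rewrite nth_zip_cond kz nth_iota // add0n => eq.
  case e: (entry K i k) => [w|].
    have [kn wn ew] := mK _ _ _ e.
    rewrite -eq /=; split=> //; apply: (aA _ w) => //.
    by rewrite -e /entry; case: (q) eq aq => [x y] [-> ->].
  by move: (aN k) => /negP[]; rewrite -e /entry; case: (q) eq aq => [x y] [-> ->].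
rewrite -size_filter -(size_map (fun q => val p q.2)) cardE.
apply: uniq_leq_size => [|x /mapP[q /zP[_ qA] ->]]; last by rewrite mem_enum.
rewrite map_inj_in_uniq => [|q q' /[dup] qz /zP[qn _] /[dup] q'z /zP[q'n _] e].
  apply: filter_uniq; have: uniq (unzip2 z); last exact: map_uniq.
  have -> : unzip2 z = take (size (nth [::] K i)) (iota 0 11).
    by rewrite /z; elim: (nth _ _ _) (iota _ _) => [|x l IHl] [|y l'] //=; rewrite IHl.
  exact/take_uniq/iota_uniq.
have e2: q.2 = q'.2 by apply/eqP; rewrite -(nth_uniq ord0 qn q'n up); apply/eqP.
have e1 t : t \in z -> t.1 = nth None (nth [::] K i) t.2.
  case/(nthP (None, 0)) => k kz <-.
  rewrite nth_zip_cond kz -[(_, _).2]/(nth 0 (iota 0 11) k) nth_iota //.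
  by move: kz; rewrite size_zip size_iota leq_min => /andP[].
move: qz q'z; rewrite !mem_filter => /andP[_ /e1 eq1] /andP[_ /e1 eq2].
by apply/eqP; rewrite -pair_eqE /= eq1 eq2 e2 !eqxx.
Qed.

Lemma not_overfull (p : seq 'I_11) K i :
  i < r -> uniq p -> models act (val p) (size p) K ->
  ~~ overfull (nth [::] K i).
Proof.
move=> ir up mK; rewrite /overfull.
set f := count _ _; set m := count _ _.
have fF : f <= #|[set x | s i x == x]|.
  apply: (card_bound up mK) => // v w /= /eqP-> vn e _.
  by rewrite inE e.
have mM : m <= #|~: [set x | s i x == x]|.
  apply: (card_bound up mK) => // v w /= wv vn e wn.
  by rewrite !inE e nth_uniq.
have := cardsC [set x | s i x == x]; rewrite card_ord.
move: fF mM; move: (s_fixes ir); rewrite !inE.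
case/orP=> /eqP-> fF mM e; move: mM.
  have -> : #|~: [set x | s i x == x]| = 8 by apply/eqP; rewrite -(eqn_add2l 3) e.
  by rewrite ltnNge fF /= -leqNgt.
have -> : #|~: [set x | s i x == x]| = 4 by apply/eqP; rewrite -(eqn_add2l 7) e.
case: ifP => [_|_] m4; first by rewrite ltnNge fF /= -leqNgt.
by rewrite -leqNgt (leq_trans m4).
Qed.

(** Every queued triple, and every triple deduced from a square, holds in the action, so no
    contradiction can arise. *)
Lemma propagate_sound (p : seq 'I_11) fuel K q :
  uniq p -> models act (val p) (size p) K ->
  (forall i v w, (i, v, w) \in q ->
     [/\ i < r, v < size p, w < size p & s i (val p v) = val p w]) ->
  exists2 K', propagate r fuel K q = Some K' & models act (val p) (size p) K'.
Proof.
move=> up; elim: fuel K q => [|fuel IHf] K q mK qP /=; first by exists K.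
case: q qP => [|[[i v] w] q] qP; first by exists K.
have [ir vn wn e] := qP i v w (mem_head _ _).
have qP' j a b : (j, a, b) \in q ->
    [/\ j < r, a < size p, b < size p & s j (val p a) = val p b].
  by move=> jq; apply: qP; rewrite inE jq orbT.
have inj a b : a < size p -> b < size p -> val p a = val p b -> a = b.
  by move=> an bn ab; apply/eqP; rewrite -(nth_uniq ord0 an bn up); apply/eqP.
case ev: (entry K i v) => [a|].
  have [_ an ea] := mK _ _ _ ev.
  by rewrite (inj a w) ?eqxx //; [exact: IHf | rewrite -ea].
case ew: (entry K i w) => [b|].
  have [_ bn eb] := mK _ _ _ ew.
  rewrite (inj b v) ?eqxx //; first exact: IHf.
  by rewrite -eb -e /act sK.
have mK' : models act (val p) (size p) (link K i v w).
  by apply: models_link => // j; exact: sK.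
rewrite (negbTE (not_overfull ir up mK')).
apply: IHf => // j a b; rewrite mem_cat => /orP[|/qP' //].
case/flattenP=> l /mapP[k]; rewrite mem_iota add0n => /= kr ->.
case: ifP => // ik.
case ea: (entry _ k v) => [a'|]; case eb: (entry _ k w) => [b'|] //=.
- have [_ a'n ea'] := mK' _ _ _ ea; have [_ b'n eb'] := mK' _ _ _ eb.
  rewrite inE mem_cat => /orP[/eqP[-> -> ->]|].
    by split=> //; rewrite -ea' -eb' -e /act (s_far ir kr ik).
  case/orP; case ec: entry => [c|] //; have [_ cn ec'] := mK' _ _ _ ec;
    rewrite inE => /eqP[-> -> ->]; split=> //.
    by rewrite -ec' -ea' -e /act (s_far ir kr ik).
  by rewrite -ec' -eb' -e /act (s_far ir kr ik) sK.
- have [_ a'n ea'] := mK' _ _ _ ea.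
  rewrite cats0; case ec: entry => [c|] //; have [_ cn ec'] := mK' _ _ _ ec.
  rewrite inE => /eqP[-> -> ->]; split=> //.
  by rewrite -ec' -ea' -e /act (s_far ir kr ik).
- have [_ b'n eb'] := mK' _ _ _ eb.
  case ec: entry => [c|] //; have [_ cn ec'] := mK' _ _ _ ec.
  rewrite inE => /eqP[-> -> ->]; split=> //.
  by rewrite -ec' -eb' -e /act (s_far ir kr ik) sK.
Qed.

Arguments propagate : simpl never.

Lemma uniq_ord_size n (p : seq 'I_n) : uniq p -> size p <= n.
Proof. by move/card_uniqP <-; rewrite -[leqRHS]card_ord max_card. Qed.

(** The given action singles out a path through the search tree: at each branching the true image is
    among the candidates. The search succeeds on all branches, so in particular at the leaf ending
    this path. *)
Lemma search_sound order leaf fuel K (p : seq 'I_11) :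
  perm_eq order (iota 0 r) -> 0 < size p -> uniq p ->
  models act (val p) (size p) K ->
  search r order leaf fuel K (size p) ->
  exists p' K', [/\ uniq p', size p' = 11,
    models act (val p') 11 K',
    forall i v, i < r -> v < 11 -> entry K' i v & leaf K'].
Proof.
move=> or_; elim: fuel K p => //= fuel IHf K p p0 up mK.
set c := cells _ _; set k := find _ _.
have mem_c i v : ((i, v) \in c) = (i < r) && (v < size p).
  apply/allpairsP/andP => [[[x y] [/= xp yo [-> ->]]]|[ir vp]].
    by move: xp yo; rewrite (perm_mem or_) !mem_iota.
  by exists (v, i); rewrite (perm_mem or_) !mem_iota.
case: eqP => [kc|/eqP kc].
  have full i v : i < r -> v < size p -> entry K i v.
    move=> ir vn; have ic: (i, v) \in c by rewrite mem_c ir.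
    have: ~~ has (fun x => ~~ entry K x.1 x.2) c by rewrite has_find -/k kc ltnn.
    by move/hasPn/(_ _ ic); rewrite negbK.
  have p11 : size p = 11.
    (* The named points are closed under the generators, so transitivity makes them everything. *)
    have A1: [set x in p] = setT.
      apply: s_trans.
        by apply/set0Pn; exists (val p 0); rewrite inE mem_nth.
      move=> i x ir; rewrite !inE => /(nthP ord0)[v vn <-].
      move: (full i v ir vn); case e: entry => [w|] // _.
      have [_ wn] := mK _ _ _ e; rewrite /act => ->.
      exact: mem_nth.
    apply/eqP; rewrite eqn_leq uniq_ord_size //= -{1}(card_ord 11) -cardsT -A1.
    by rewrite (leq_trans _ (card_size p)) // cardsE.
  rewrite p11 /= in mK full * => lK; exists p, K.
  by split.
have kc' : k < size c by rewrite ltn_neqAle kc find_size.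
case ek: (nth (0, 0) c k) => [i v].
have := mem_nth (0, 0) kc'; rewrite ek mem_c => /andP[ir vn] /allP all_w.
pose y := s i (val p v).
have [p' [w [up' pp' wn' ew]]] : exists p' w,
    [/\ uniq p', forall u, u < size p -> val p' u = val p u, w < size p'
      & [/\ val p' w = y, size p' = maxn (size p) w.+1 & w <= size p]].
  have [yp|yp] := boolP (y \in p).
    exists p, (index y p); rewrite index_mem yp; split=> //.
    rewrite /val nth_index //; split=> //; last exact: index_size.
    by apply/esym/maxn_idPl; rewrite index_mem.
  exists (rcons p y), (size p); split; rewrite ?rcons_uniq ?yp ?size_rcons //.
    by move=> u un; rewrite /val nth_rcons un.
  rewrite /val nth_rcons ltnn eqxx; split=> //.
  by apply/esym/maxn_idPr.
case: ew => ew sp' w1.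
have w11 : w < 11 by apply: leq_trans wn' (uniq_ord_size up').
have := all_w w; rewrite mem_iota add0n leq_min w11 ltnS w1 => /(_ isT).
have le_p : size p <= size p' by rewrite sp' leq_maxl.
have mK' : models act (val p') (size p') K.
  move=> j a b /mK[an bn e]; split; rewrite ?(leq_trans _ le_p) //.
  by rewrite !pp'.
have [|K' -> mK''] := @propagate_sound p' 100 K [:: (i, v, w)] up' mK'.
  move=> j a b; rewrite inE => /eqP[-> -> ->]; split; rewrite ?(leq_trans vn) //.
  by rewrite pp' // ew.
rewrite -sp'; apply: IHf => //; exact: leq_trans p0 le_p.
Qed.

End Search.

(** * Words in generators *)

Section Eval.
Variables (H : groupType) (x : nat -> H).

Fixpoint eval (w : seq nat) : H :=
  if w is i :: w' then (x i * eval w')%g else 1%g.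

Lemma eval_cat u v : eval (u ++ v) = (eval u * eval v)%g.
Proof. by elim: u => [|i u IHu] /=; rewrite ?mul1g // IHu mulgA. Qed.

Lemma eval_flatten_nseq n w : eval (flatten (nseq n w)) = (eval w ^+ n)%g.
Proof. by elim: n => [|n IHn] //=; rewrite eval_cat IHn expgS. Qed.

Lemma run_eval h w : run (fun i h => (h * x i)%g) h w = (h * eval w)%g.
Proof. by elim: w h => [|i w IHw] h /=; rewrite ?mulg1 // IHw mulgA. Qed.

Hypothesis x_inv : forall i, (x i * x i)%g = 1%g.

Lemma eval_rev w : eval (rev w) = ((eval w)^-1)%g.
Proof.
elim: w => [|i w IHw]; first by rewrite invg1.
rewrite rev_cons -cats1 eval_cat IHw /= mulg1 invgM; congr (_ * _)%g.
by apply: (mulgI (x i)); rewrite x_inv mulgV.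
Qed.

Lemma eval_eq u v : (eval u == eval v) = (eval (u ++ rev v) == 1%g).
Proof.
rewrite eval_cat eval_rev; apply/eqP/eqP => [->|e]; first exact: mulgV.
by rewrite -[LHS](mulgKV (eval v)) e mul1g.
Qed.

End Eval.

Lemma eq_eval (H : groupType) (x y : nat -> H) r w :
  (forall i, i < r -> x i = y i) -> all (gtn r) w -> eval x w = eval y w.
Proof. by move=> e; elim: w => //= i w IHw /andP[/e-> /IHw->]. Qed.

Lemma morph_eval (gT rT : finGroupType) (G : {group gT})
    (f : {morphism G >-> rT}) (x : nat -> gT) w :
  (forall i, x i \in G) ->
  eval x w \in G /\ f (eval x w) = eval (f \o x) w.
Proof.
move=> Gx; elim: w => [|i w [Gw IHw]] /=; first by rewrite group1 morph1.
by rewrite groupM // morphM // IHw.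
Qed.

Lemma run_rcons T (act : nat -> T -> T) t w i :
  run act t (rcons w i) = act i (run act t w).
Proof. by rewrite /run foldl_rcons. Qed.

Lemma stable_run (A : eqType) (f : nat -> A -> A) M D a w :
  stable f M D -> {subset w <= M} -> a \in D -> run f a w \in D.
Proof.
move=> /allP sD; elim: w a => //= i w IHw a wM aD; apply: IHw.
  by move=> j jw; apply: wM; rewrite inE jw orbT.
have /allP/(_ i (wM i (mem_head _ _))) := sD a aD.
by rewrite lazy_hasE has_pred1.
Qed.

Section Image.
Variables (r : nat) (s : nat -> {perm 'I_11}) (p : seq 'I_11) (K : table).
Hypothesis up : uniq p.
Hypothesis p11 : size p = 11.
Hypothesis mK : models (fun i x => s i x) (fun v => nth ord0 p v) 11 K.
Hypothesis Kfull : forall i v, i < r -> v < 11 -> entry K i v.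

Lemma image_eval w : all (gtn r) w ->
  size (image K w) = 11 /\ forall v, v < 11 ->
    nth 0 (image K w) v < 11 /\
    nth ord0 p (nth 0 (image K w) v) = eval s w (nth ord0 p v).
Proof.
elim/last_ind: w => [_|w i IHw].
  split=> [|v v11]; first by rewrite /image size_iota.
  have e: nth 0 (iota 0 11) v = v by rewrite nth_iota.
  by change (image K [::]) with (iota 0 11); rewrite e perm1.
rewrite all_rcons => /andP[ir /IHw[sz IH]].
rewrite /image run_rcons -/(image K w) /step size_map; split=> // v v11.
have [y11 ey] := IH v v11; rewrite (nth_map 0) ?sz //.
move: (Kfull ir y11); case e: entry => [y|] // _.
have [_ y'11 /= <-] := mK e; split=> //.
by rewrite ey -cats1 eval_cat permM /= mulg1.
Qed.

(** All 11 points have names, so a permutation is determined by its effect on names. *)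
Lemma image_eq u v : all (gtn r) u -> all (gtn r) v ->
  (image K u == image K v) = (eval s u == eval s v).
Proof.
move=> ur vr; have [su iu] := image_eval ur; have [sv iv] := image_eval vr.
apply/eqP/eqP => [e|e].
  apply/permP=> x; have /(nthP ord0)[k] : x \in p.
    have: [set y in p] = setT.
      apply/eqP; rewrite eqEcard subsetT cardsT card_ord cardsE.
      by rewrite (card_uniqP up) p11.
    by move/setP/(_ x); rewrite !inE.
  rewrite p11 => k11 <-.
  by have [_ <-] := iu k k11; have [_ <-] := iv k k11; rewrite e.
apply: (eq_from_nth (x0 := 0)); rewrite su ?sv // => k k11.
have [k1 e1] := iu k k11; have [k2 e2] := iv k k11.
by apply/eqP; rewrite -(nth_uniq ord0 _ _ up) ?p11 // e1 e2 e.
Qed.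

Lemma image_eq1 w : all (gtn r) w ->
  (image K w == iota 0 11) = (eval s w == 1%g).
Proof. by move=> wr; rewrite -(image_eq wr (v := [::])). Qed.

End Image.

(** * Classification of tuples of permutations *)

(** Induction on the number of moved points: multiplying by the transposition of [x] and [s x]
    leaves an involution with two fewer moved points and opposite parity. *)
Lemma involution_parity (T : finType) (s : {perm T}) :
  involutive s ->
  ~~ odd #|[set x | s x != x]| /\ odd_perm s = odd #|[set x | s x != x]|./2.
Proof.
move: {2}#|_|.+1 (ltnSn #|[set x | s x != x]|) => n.
elim: n s => // n IHn s; rewrite ltnS => le_n sK.
have [s0|[x]] := set_0Vmem [set x | s x != x].
  suff -> : s = 1%g.
    by rewrite odd_perm1 (_ : [set x | _] = set0) ?cards0 //;
       apply/setP=> x; rewrite !inE perm1 eqxx.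
  apply/permP=> x; rewrite perm1; apply/eqP/negbNE.
  by have /setP/(_ x) := s0; rewrite !inE => ->.
rewrite inE => sx; pose t := (tperm x (s x) * s)%g.
have tE z : t z = if (z == x) || (z == s x) then z else s z.
  rewrite permM; case: tpermP => [->|->|/eqP/negbTE-> /eqP/negbTE->] //.
    by rewrite sK eqxx.
  by rewrite eqxx orbT.
have tK : involutive t.
  move=> z; rewrite [t z]tE; case: ifP => zx; rewrite tE ?zx //.
  by rewrite (inj_eq perm_inj) (can2_eq sK sK) orbC zx sK.
have Dm : [set z | s z != z] = x |: (s x |: [set z | t z != z]).
  apply/setP=> z; rewrite !inE tE; case: (z =P x) => [->|_] /=.
    by rewrite sx.
  by case: (z =P s x) => [->|_] //=; rewrite sK eq_sym sx.
have card_m : #|[set z | s z != z]| = #|[set z | t z != z]|.+2.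
  by rewrite Dm !cardsU1 !inE !tE !eqxx orbT /= eqxx orbF eq_sym sx.
have [|ev od] := IHn t _ tK; first by rewrite -ltnS -card_m ltnW.
rewrite card_m /= negbK; split=> //.
by rewrite -od odd_mul_tperm eq_sym sx addTb negbK.
Qed.

(** The number of moved points is positive, divisible by 4 and at most 11. *)
Lemma even_involution_fixes (s : {perm 'I_11}) :
  involutive s -> s != 1%g -> s \in ('Alt_('I_11))%g ->
  #|[set x | s x == x]| \in [:: 3; 7].
Proof.
move=> sK s1; rewrite Alt_even => ev.
have [ev2 ev4] := involution_parity sK; rewrite (negbTE ev) in ev4.
have m0 : #|[set x | s x != x]| != 0.
  rewrite cards_eq0; apply: contraNneq s1 => s0; apply/eqP/permP=> x.
  by rewrite perm1; apply/eqP/negbNE; have /setP/(_ x) := s0; rewrite !inE => ->.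
have := cardsC [set x | s x == x]; rewrite card_ord.
have -> : ~: [set x | s x == x] = [set x | s x != x] by apply/setP=> x; rewrite !inE.
move: #|[set x | s x != x]| #|[set x | s x == x]| m0 ev2 ev4 => m f m0 ev2 ev4 e.
have : m <= 11 by rewrite -e leq_addl.
move: m0 ev2 ev4 e; do 12?[case: m => [|m] //].
  by move=> _ _ _ /eqP; rewrite -[11]/(7 + 4) eqn_add2r => /eqP->.
by move=> _ _ _ /eqP; rewrite -[11]/(3 + 8) eqn_add2r => /eqP->.
Qed.

(** The intersection property for words, with the letters of [u] and of [v] as the two index
    sets. *)
Definition word_ip (r : nat) (H : groupType) (x : nat -> H) : Prop :=
  forall u v, all (gtn r) u -> all (gtn r) v -> eval x u = eval x v ->
  exists w, [/\ {subset w <= u}, {subset w <= v} & eval x w = eval x u].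

Definition cellular (H : groupType) (x : nat -> H) : Prop :=
  (forall i, (x i * x i)%g = 1%g) /\
  (forall R, R \in cell_relators -> eval x R = 1%g).

(** Together with [cellular] this determines which words are trivial, as [eval_cell1] shows. *)
Definition separated (H : groupType) (x : nat -> H) : Prop :=
  forall w, w \in behead cell_words -> eval x w != 1%g.

Lemma cell_relators_letters : all (all (gtn 4)) cell_relators.
Proof. by []. Qed.

Lemma cell_words_letters : all (all (gtn 4)) cell_words.
Proof. by vm_compute. Qed.

Section Leaf.
Variables (r : nat) (s : nat -> {perm 'I_11}) (p : seq 'I_11) (K : table).
Hypothesis up : uniq p.
Hypothesis p11 : size p = 11.
Hypothesis mK : models (fun i x => s i x) (fun v => nth ord0 p v) 11 K.
Hypothesis Kfull : forall i v, i < r -> v < 11 -> entry K i v.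

(** The intersection property yields a word in the common letters, whose image would lie in the list
    it is said to avoid. *)
Lemma kills_sound u v : r <= 5 -> word_ip r s ->
  all (gtn r) u -> all (gtn r) v -> ~~ kills K (u, v).
Proof.
move=> r5 ip ur vr; rewrite /kills /=; case: ifP => //.
rewrite (image_eq up p11 mK Kfull) // => /eqP e.
have [w [wu wv ew]] := ip u v ur vr e.
have wr : all (gtn r) w by apply/allP=> i /wu /(allP ur).
apply/negP=> /and3P[sD i0 /negP[]].
rewrite -(eqP (_ : image K w == image K u)).
  apply: (stable_run sD) => // i iw.
  rewrite mem_filter wu // wv // mem_iota /=.
  exact: leq_trans (allP wr i iw) r5.
by rewrite (image_eq up p11 mK Kfull) // ew.
Qed.

Lemma is_cell_sound : r = 4 -> (forall i, involutive (s i)) ->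
  is_cell K -> cellular s /\ separated s.
Proof.
move=> r4 sK /andP[/allP rel /allP wd]; split; last first.
  move=> w ww; have := wd w ww; rewrite (image_eq1 up p11 mK Kfull) // r4.
  by apply: (allP cell_words_letters); apply: mem_behead.
split=> [i|R RR]; first by apply/permP=> x; rewrite permM perm1 sK.
have := rel R RR; rewrite (image_eq1 up p11 mK Kfull) => [/eqP|] //.
by rewrite r4; apply: (allP cell_relators_letters).
Qed.

End Leaf.

(* The base point is chosen among the fixed points of generator [b]. *)
Definition start (b : nat) : table := put [::] b 0 0.

(** The exhaustive search, by computation. Soundness accepts any order of the generators; the list
    is a matter of strategy. *)
Lemma search4 : search 4 [:: 1; 3; 0; 2] (leaf 4 certificates4) 60 (start 1) 1.
Proof. by vm_cast_no_check (erefl true). Qed.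

Lemma search5 : search 5 [:: 2; 0; 4; 1; 3] (leaf 5 certificates5) 60 (start 2) 1.
Proof. by vm_cast_no_check (erefl true). Qed.

Lemma certificates4_letters :
  all (fun c => all (gtn 4) c.1 && all (gtn 4) c.2) certificates4.
Proof. by vm_compute. Qed.

Lemma certificates5_letters :
  all (fun c => all (gtn 5) c.1 && all (gtn 5) c.2) certificates5.
Proof. by vm_compute. Qed.

Lemma classification r (s : nat -> {perm 'I_11}) :
  r \in [:: 4; 5] -> (forall i, involutive (s i)) ->
  (forall i, i < r -> s i != 1%g /\ s i \in ('Alt_('I_11))%g) ->
  (forall i j, i < r -> j < r -> far i j -> forall x, s i (s j x) = s j (s i x)) ->
  (forall A : {set 'I_11}, A != set0 ->
    (forall i x, i < r -> x \in A -> s i x \in A) -> A = setT) ->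
  word_ip r s ->
  [/\ r = 4, cellular s & separated s].
Proof.
move=> r45 sK s_even s_far s_trans ip.
have s_fix i : i < r -> #|[set x | s i x == x]| \in [:: 3; 7].
  by move=> /s_even[s1 sA]; apply: even_involution_fixes.
have [b [order [certs [or_ br certsP srch]]]] : exists b order certs,
    [/\ perm_eq order (iota 0 r), b < r,
      all (fun c => all (gtn r) c.1 && all (gtn r) c.2) certs
      & search r order (leaf r certs) 60 (start b) 1].
  move: r45; rewrite !inE => /orP[] /eqP->.
    exists 1, [:: 1; 3; 0; 2], certificates4.
    by split; [| | exact: certificates4_letters | exact: search4].
  exists 2, [:: 2; 0; 4; 1; 3], certificates5.
  by split; [| | exact: certificates5_letters | exact: search5].
(* Generator [b] has 3 or 7 fixed points; one of them becomes the point named 0. *)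
have [x sx] : exists x, s b x = x.
  have : 0 < #|[set x | s b x == x]| by have := s_fix b br; rewrite !inE => /orP[] /eqP->.
  by case/card_gt0P=> x; rewrite inE => /eqP; exists x.
have [|||p [K [up p11 mK Kfull lK]]] :=
    search_sound sK s_far s_fix s_trans or_ (p := [:: x]) _ _ _ srch => //.
  move=> i v w; rewrite entry_put; case: andP => [[/eqP-> /eqP->] [<-]|_] //.
  by rewrite /entry nth_nil nth_nil.
move: lK; rewrite /leaf lazy_hasE; case: ifP => [/hasP[[u v] cc]|_].
  have /andP[ur vr] := allP certsP _ cc.
  have r5 : r <= 5 by move: r45; rewrite !inE => /orP[] /eqP->.
  by move=> k; have /negP[] := kills_sound up p11 mK Kfull r5 ip ur vr.
case/andP=> /eqP r4 cK; have [] := is_cell_sound up p11 mK Kfull r4 sK cK.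
by split.
Qed.

(** * The presentation of the 11-cell *)

(* A relator [a ++ i :: b] in involutions says that [i] equals
   [rev a ++ rev b]. *)
Definition rules_of (relators : seq (seq nat)) : seq (nat * seq nat) :=
  undup [seq (nth 0 R k, rev (take k R) ++ rev (drop k.+1 R))
        | R <- relators, k <- iota 0 (size R)].

(** The tree edge into [w] comes from [w] without its last letter, that is, from [belast j w'] by
    the letter [last j w']. *)
Definition graft (W : seq (seq nat)) (K : table) (w : seq nat) : table :=
  if w is j :: w' then
    let q := index (belast j w') W in
    if q < size W then link K (last j w') q (index w W) else K
  else K.

Definition tree (W : seq (seq nat)) : table := foldl (graft W) [::] W.

(* Starting from a spanning tree, two sweeps of relator deductions already
   determine the whole Cayley graph; this is coset enumeration over the trivial
   subgroup, without any coincidence. *)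
Definition cayley : table :=
  let R := rules_of cell_relators in close R 660 (close R 660 (tree cell_words)).

(** Since no entry is left open, every word can be traced through the table. *)
Lemma cayley_total :
  (size cayley == 4) && all (fun row => (size row == 660) && all isSome row) cayley.
Proof. by vm_cast_no_check (erefl true). Qed.

Lemma size_cell_words : size cell_words = 660.
Proof. by vm_compute. Qed.

Section Presentation.
Variables (H : groupType) (x : nat -> H).
Hypothesis x_cell : cellular x.

Let act i (h : H) := (h * x i)%g.
Let val k := eval x (nth [::] cell_words k).

Lemma act_inv i : involutive (act i).
Proof. by move=> h; rewrite /act -mulgA x_cell.1 mulg1. Qed.

Lemma act_rules rule h : rule \in rules_of cell_relators ->
  act rule.1 h = run act h rule.2.
Proof.
rewrite mem_undup => /allpairsPdep[R [k [RR]]].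
rewrite mem_iota add0n => /= kR -> /=; rewrite run_eval; congr (_ * _)%g.
have RE: take k R ++ nth 0 R k :: drop k.+1 R = R.
  by rewrite -drop_nth // cat_take_drop.
have := x_cell.2 R RR; rewrite -[in eval x R]RE !eval_cat !eval_rev /= => [e||];
  [|exact: x_cell.1..].
by apply: (mulgI (eval x (take k R))); apply: (mulIg (eval x (drop k.+1 R)));
   rewrite -mulgA e !mulgA mulgV mul1g mulVg.
Qed.

Lemma models_tree : models act val 660 (tree cell_words).
Proof.
have: {subset cell_words <= cell_words} by [].
have: models act val 660 [::] by move=> i v w; rewrite /entry !nth_nil.
rewrite /tree; set F := graft _.
elim: {1 3}cell_words [::] => // w W0 IHW K mK sub.
apply: IHW => [|w' w'W]; last by apply: sub; rewrite inE w'W orbT.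
have ww : w \in cell_words by apply: sub; rewrite mem_head.
rewrite /F /graft; case: w sub ww => // j w sub ww; case: ifP => // q.
have qW : belast j w \in cell_words by rewrite -index_mem.
apply: models_link; rewrite -?size_cell_words ?index_mem //; first exact: act_inv.
by rewrite /act /val !nth_index // lastI -cats1 eval_cat /= mulg1.
Qed.

(** Tree edges hold by definition and deductions follow from the relators, so the table is valid in
    every such group. Tracing [w] from the empty word finds its normal form, whose index depends on
    [w] alone and not on the group. *)
Lemma eval_cell w : all (gtn 4) w ->
  exists k, [/\ k < 660, walk cayley 0 w = Some k
    & eval x w = eval x (nth [::] cell_words k)].
Proof.
have mC : models act val 660 cayley.
  by rewrite /cayley; do 2?[apply: models_close => //;
    [exact: act_inv | exact: act_rules |]]; exact: models_tree.
(* Only totality and validity of the table matter from here on, so it is generalized. *)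
move: cayley_total mC; move: cayley => C /andP[/eqP s4 /allP rows] mC w4.
suff /(_ 0 isT)[k wk] : forall v, v < 660 -> exists k, walk C v w = Some k.
  have [k660] := models_walk mC (isT : 0 < 660) wk.
  by rewrite run_eval mul1g => e; exists k.
elim: w w4 => [_ v _|i w IHw /andP[i4 w4] v v660] /=; first by exists v.
case e: (entry C i v) => [u|].
  by have [_ u660 _] := mC _ _ _ e; apply: IHw.
have := rows (nth [::] C i); rewrite mem_nth ?s4 // => /(_ isT)/andP[/eqP sz].
by move/(all_nthP None)/(_ v); rewrite sz -/(entry C i v) e => /(_ v660).
Qed.

(** Separation makes every nonempty normal form nontrivial, so the table alone decides
    triviality. *)
Lemma eval_cell1 w : separated x -> all (gtn 4) w ->
  eval x w = 1%g <-> walk cayley 0 w = Some 0.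
Proof.
move=> sx /eval_cell[k [k660 -> ->]]; split=> [e|[->]] //.
case: k k660 e => // k k660 e; have := sx (nth [::] cell_words k.+1).
rewrite -nth_behead mem_nth ?size_behead ?size_cell_words //.
by rewrite nth_behead e eqxx => /(_ isT).
Qed.

End Presentation.

(** * Groups with generators *)

Lemma cellular_relations (H : groupType) (x : nat -> H) :
  (forall i, 4 <= i -> x i = 1%g) ->
  cellular x <-> eleven_cell_relations (x 0) (x 1) (x 2) (x 3).
Proof.
move=> x4; split=> [[inv rel]|[[r0 r1 r2 r3] [r01 r12 r23] [r02 r03 r13] [r5 r5']]].
  have powR n w : flatten (nseq n w) \in cell_relators -> (eval x w ^+ n)%g = 1%g.
    by rewrite -eval_flatten_nseq => /rel.
  do ![split]; rewrite ?expg2 ?inv //.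
  - by have := powR 3 [:: 0; 1] isT; rewrite /= mulg1.
  - by have := powR 5 [:: 1; 2] isT; rewrite /= mulg1.
  - by have := powR 3 [:: 2; 3] isT; rewrite /= mulg1.
  - by have := powR 2 [:: 0; 2] isT; rewrite /= mulg1 expg2.
  - by have := powR 2 [:: 0; 3] isT; rewrite /= mulg1 expg2.
  - by have := powR 2 [:: 1; 3] isT; rewrite /= mulg1 expg2.
  - by have := powR 5 [:: 0; 1; 2] isT; rewrite /= mulg1 mulgA.
  - by have := powR 5 [:: 1; 2; 3] isT; rewrite /= mulg1 mulgA.
split.
  case=> [|[|[|[|i]]]]; rewrite -?expg2 //.
  by rewrite x4 // expg1n.
have two i j : eval x [:: i; j; i; j] = ((x i * x j) ^+ 2)%g.
  by rewrite /= mulg1 expg2 !mulgA.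
move=> R; rewrite !inE; do 7?[case/orP]; move/eqP->;
  rewrite ?two ?eval_flatten_nseq //= mulg1 ?mulgA //.
Qed.

Section Generated.
Variable Gamma : group_with_gens.

(** Beyond the rank the value is 1, so that for an sggi all [gen i] square to 1. *)
Definition gen (i : nat) : carrier Gamma := nth 1%g (gens Gamma) i.

Lemma gen_rho (i : 'I_(sgrank Gamma)) : gen i = rho i.
Proof. by rewrite /gen /rho (tnth_nth 1%g). Qed.

Lemma gen_subP (J : {set 'I_(sgrank Gamma)}) g :
  g \in gen_sub J <->
  exists w, (forall i, i \in w -> exists2 j, j \in J & i = val j) /\
    eval gen w = g.
Proof.
split.
  case/gen_prodgP=> n [c cJ ->]; elim: n c cJ => [|n IHn] c cJ.
    by exists [::]; rewrite big_ord0.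
  have [w [wJ ew]] := IHn (fun i => c (lift ord0 i)) (fun i => cJ _).
  have /imsetP[j jJ ej] := cJ ord0.
  exists (val j :: w); split=> [i|]; last first.
    by rewrite big_ord_recl /= ew gen_rho ej.
  by rewrite inE => /predU1P[->|/wJ]; first exists j.
case=> w [wJ <-]; elim: w wJ => [|i w IHw] wJ /=; first exact: group1.
rewrite groupM ?IHw // => [|k kw]; last by apply: wJ; rewrite inE kw orbT.
have [j jJ ->] := wJ i (mem_head _ _).
by rewrite gen_rho mem_gen // imset_f.
Qed.

Hypothesis gen_grp : gen_sub [set: 'I_(sgrank Gamma)] = grp Gamma.

Lemma eval_grp w : eval gen w \in grp Gamma.
Proof.
elim: w => [|i w IHw] /=; first exact: group1.
rewrite groupM //; have [ir|ri] := ltnP i (sgrank Gamma).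
  by rewrite -gen_grp (gen_rho (Ordinal ir)) mem_gen ?imset_f.
by rewrite /gen nth_default ?size_tuple ?group1.
Qed.

Lemma grp_eval g : g \in grp Gamma ->
  exists2 w, all (gtn (sgrank Gamma)) w & eval gen w = g.
Proof.
rewrite -gen_grp => /gen_subP[w [wr <-]]; exists w => //.
by apply/allP=> i /wr[j _ ->] /=.
Qed.

(** Choose a word for each element and evaluate it at [y]. The choice does not matter: if [u] and
    [v] agree in the group, then [u ++ rev v] is trivial there, hence trivial at [y]. *)
Lemma extend_words (H : groupType) (y : nat -> H) :
  (forall i, gen i * gen i = 1)%g -> (forall i, y i * y i = 1)%g ->
  (forall w, all (gtn (sgrank Gamma)) w -> eval gen w = 1%g -> eval y w = 1%g) ->
  exists phi : carrier Gamma -> H,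
    {in grp Gamma &, {morph phi : a b / (a * b)%g}} /\
    forall w, all (gtn (sgrank Gamma)) w -> phi (eval gen w) = eval y w.
Proof.
move=> gI yI ker.
have [f fP] : exists f : carrier Gamma -> seq nat, forall g, g \in grp Gamma ->
    all (gtn (sgrank Gamma)) (f g) /\ eval gen (f g) = g.
  apply: (@fin_all_exists _ (fun _ => seq nat) (fun g w => g \in grp Gamma ->
    all (gtn (sgrank Gamma)) w /\ eval gen w = g)) => g.
  case: (boolP (g \in grp Gamma)) => [|_].
    by case/grp_eval=> w wr ew; exists w.
  by exists [::].
have fE w : all (gtn (sgrank Gamma)) w ->
    eval y (f (eval gen w)) = eval y w.
  have [fr fe] := fP _ (eval_grp w); move=> wr.
  apply/eqP; rewrite eval_eq //; apply/eqP/ker.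
    by rewrite all_cat fr all_rev.
  by apply/eqP; rewrite -eval_eq // fe.
exists (fun g => eval y (f g)); split=> // a b.
case/grp_eval=> u ur <- /grp_eval[v vr <-].
by rewrite -(eval_cat gen) !fE ?eval_cat // all_cat ur.
Qed.

Lemma sggi_gen_inv : is_sggi Gamma -> forall i, (gen i * gen i = 1)%g.
Proof.
case=> _ ord2 _ i; have [ir|ri] := ltnP i (sgrank Gamma).
  by rewrite (gen_rho (Ordinal ir)) -expg2 -(ord2 (Ordinal ir)) expg_order.
by rewrite /gen nth_default ?size_tuple ?mulg1.
Qed.

Lemma string_C_word_ip :
  is_string_C_group Gamma -> word_ip (sgrank Gamma) gen.
Proof.
case=> _ ip u v ur vr e.
pose L (w : seq nat) := [set j : 'I_(sgrank Gamma) | val j \in w].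
have inL w : all (gtn (sgrank Gamma)) w -> eval gen w \in gen_sub (L w).
  move=> wr; apply/gen_subP; exists w; split=> // i iw.
  by exists (Ordinal (allP wr i iw)); rewrite ?inE.
have : eval gen u \in gen_sub (L u) :&: gen_sub (L v).
  by rewrite inE inL // e inL.
rewrite ip => /gen_subP[w [wL ew]]; exists w; split=> // i /wL[j];
  by rewrite !inE => /andP[ju jv] ->.
Qed.

Lemma word_ip_string_C :
  is_sggi Gamma -> word_ip (sgrank Gamma) gen -> is_string_C_group Gamma.
Proof.
move=> sg ip; split=> // J K; apply/eqP; rewrite eqEsubset.
have gen_subS (A B : {set 'I_(sgrank Gamma)}) : A \subset B ->
    gen_sub A \subset gen_sub B.
  by move=> AB; apply/genS/imsetS.
rewrite subsetI !gen_subS ?subsetIl ?subsetIr // !andbT.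
apply/subsetP=> g; rewrite inE => /andP[/gen_subP[u [uJ eu]] /gen_subP[v [vK ev]]].
have ur : all (gtn (sgrank Gamma)) u by apply/allP=> i /uJ[j _ ->] /=.
have vr : all (gtn (sgrank Gamma)) v by apply/allP=> i /vK[j _ ->] /=.
have [|w [wu wv ew]] := ip u v ur vr; first by rewrite eu.
apply/gen_subP; exists w; split=> [i iw|]; last by rewrite ew.
have [j jJ ij] := uJ i (wu i iw); have [k kK ik] := vK i (wv i iw).
by exists j => //; rewrite inE jJ (_ : j = k) //; apply: val_inj; rewrite -ij.
Qed.

End Generated.

(** One implication between trivial words gives a morphism by [extend_words], the other its
    injectivity; it is onto because generators go to generators. *)
Lemma words_string_iso (Gamma Delta : group_with_gens) :
  is_sggi Gamma -> is_sggi Delta -> sgrank Gamma = sgrank Delta ->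
  (forall w, all (gtn (sgrank Gamma)) w ->
    eval (gen Gamma) w = 1%g <-> eval (gen Delta) w = 1%g) ->
  string_iso Gamma Delta.
Proof.
move=> sG sD rk ww; have [gG _ _] := sG; have [gD _ _] := sD.
have [phi [phiM phiE]] := extend_words gG (sggi_gen_inv sG) (sggi_gen_inv sD)
  (fun w wr => (ww w wr).1).
exists (Morphism phiM); split.
  apply/isomP; split.
    apply/injmP=> a b /(grp_eval gG)[u ur <-] /(grp_eval gG)[v vr <-] /=.
    rewrite !phiE // => /eqP; rewrite eval_eq; last exact: sggi_gen_inv.
    move/eqP/ww => e; apply/eqP; rewrite eval_eq; last exact: sggi_gen_inv.
    by rewrite e // all_cat ur all_rev.
  rewrite morphimEdom; apply/eqP; rewrite eqEsubset; apply/andP; split.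
    apply/subsetP=> _ /imsetP[a /(grp_eval gG)[u ur <-] ->] /=.
    by rewrite phiE // eval_grp.
  apply/subsetP=> _ /(grp_eval gD)[w wr <-]; rewrite -rk in wr.
  by apply/imsetP; exists (eval (gen Gamma) w); rewrite ?eval_grp //= phiE.
apply: (eq_from_nth (x0 := 1%g)); rewrite ?size_map !size_tuple // => i ir.
rewrite (nth_map 1%g) ?size_tuple //=.
have := phiE [:: i]; rewrite /= !mulg1 => -> //.
by rewrite ir.
Qed.

Lemma cell_string_iso (Gamma Delta : group_with_gens) :
  is_sggi Gamma -> is_sggi Delta -> sgrank Gamma = 4 -> sgrank Delta = 4 ->
  cellular (gen Gamma) -> separated (gen Gamma) ->
  cellular (gen Delta) -> separated (gen Delta) ->
  string_iso Gamma Delta.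
Proof.
move=> sG sD rG rD cG pG cD pD; apply: words_string_iso; rewrite ?rG ?rD // => w w4.
by rewrite (eval_cell1 cG pG w4) (eval_cell1 cD pD w4).
Qed.

(** * The 11-cell as a permutation group *)

Lemma cell_rows_ok :
  all (fun row => (size row == 11) && all (fun v => (nth 0 row v < 11) &&
    (nth 0 row (nth 0 row v) == v)) (iota 0 11)) cell_rows.
Proof. by []. Qed.

Lemma cell_rowP i : i < 4 -> size (nth [::] cell_rows i) = 11 /\
  forall v, v < 11 -> nth 0 (nth [::] cell_rows i) v < 11 /\
    nth 0 (nth [::] cell_rows i) (nth 0 (nth [::] cell_rows i) v) = v.
Proof.
move=> i4; have := allP cell_rows_ok _ (mem_nth [::] (i4 : i < size cell_rows)).
case/andP=> /eqP sz /allP rowP; split=> // v v11.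
by have /rowP/andP[? /eqP] : v \in iota 0 11 by rewrite mem_iota.
Qed.

(** The defaults make this the identity for [i >= 4], so it is an involution for every [i]. *)
Definition row_fun (i : nat) (x : 'I_11) : 'I_11 :=
  inord (nth (x : nat) (nth [::] cell_rows i) x).

Lemma row_funE i (x : 'I_11) : i < 4 ->
  row_fun i x = nth 0 (nth [::] cell_rows i) x :> nat /\
  nth 0 (nth [::] cell_rows i) (nth 0 (nth [::] cell_rows i) x) = x.
Proof.
move=> /cell_rowP[sz /(_ x (ltn_ord x))[lt11 e]].
by rewrite /row_fun (set_nth_default 0) ?sz ?inordK.
Qed.

Lemma row_funK i : involutive (row_fun i).
Proof.
move=> x; apply: val_inj; have [i4|i4] := ltnP i 4.
  by rewrite /= (row_funE _ i4).1 (row_funE x i4).1 (row_funE _ i4).2.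
by rewrite /row_fun [nth _ cell_rows i]nth_default // !nth_nil !inord_val.
Qed.

Definition cell_perm (i : nat) : {perm 'I_11} := perm (inv_inj (row_funK i)).

Lemma cell_permK i : involutive (cell_perm i).
Proof. by move=> x; rewrite !permE row_funK. Qed.

Lemma models_cell_table :
  models (fun i x => cell_perm i x) (fun v => nth ord0 (enum 'I_11) v) 11
    cell_table.
Proof.
move=> i v w; rewrite /entry /cell_table.
have [i4|i4] := ltnP i 4; last by rewrite (nth_default [::]) // nth_nil.
have [sz rowP] := cell_rowP i4; rewrite (nth_map [::]) //.
have [v11|v11] := ltnP v 11; last by rewrite nth_default // size_map sz.
rewrite (nth_map 0) ?sz // => -[<-]; have [w11 _] := rowP v v11.
split=> //; apply: ord_inj.
by rewrite permE (row_funE _ i4).1 !nth_enum_ord.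
Qed.

Lemma cell_table_full i v : i < 4 -> v < 11 -> entry cell_table i v.
Proof.
move=> i4 v11; rewrite /entry /cell_table (nth_map [::]) //.
have [sz _] := cell_rowP i4.
by rewrite (nth_map 0) ?sz.
Qed.

Lemma cell_perm_cell : cellular cell_perm /\ separated cell_perm.
Proof.
have c : is_cell cell_table by vm_cast_no_check (erefl true).
exact: (is_cell_sound (enum_uniq 'I_11) (size_enum_ord 11) models_cell_table
  cell_table_full (erefl 4) cell_permK c).
Qed.

(** The source of self-duality: the reversed rows are computed to pass the same test. For [i > 3]
    the truncated [3 - i] is 0, which still gives an involution. *)
Lemma dual_perm_cell :
  cellular (fun i => cell_perm (3 - i)) /\ separated (fun i => cell_perm (3 - i)).
Proof.
have c : is_cell (rev cell_table) by vm_cast_no_check (erefl true).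
have revE i v : i < 4 -> entry (rev cell_table) i v = entry cell_table (3 - i) v.
  by move=> i4; rewrite /entry nth_rev.
apply: (is_cell_sound (enum_uniq 'I_11) (size_enum_ord 11) _ _ (erefl 4) _ c).
- move=> i v w; have [i4|i4] := ltnP i 4.
    by rewrite revE // => /models_cell_table.
  by rewrite /entry (nth_default [::]) ?nth_nil.
- move=> i v i4 v11; rewrite revE //; apply: cell_table_full => //.
  by rewrite ltnS leq_subr.
- by move=> i; apply: cell_permK.
Qed.

(** * Intersection property of the 11-cell *)

Fixpoint sublists (s : seq nat) : seq (seq nat) :=
  if s is i :: s' then sublists s' ++ map (cons i) (sublists s') else [:: [::]].

Lemma filter_sublists a s : filter a s \in sublists s.
Proof.
elim: s => //= i s IHs; rewrite mem_cat; case: (a i); last by rewrite IHs.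
by rewrite (map_f (cons i) IHs) orbT.
Qed.

Definition parabolic (J : seq nat) : seq (seq nat * seq nat) :=
  orbit_words (step cell_table) J (iota 0 11).

(** Intersecting with the whole group needs no computation, so the full set of letters is left
    out. *)
Definition proper_subsets : seq (seq nat) :=
  [seq J <- sublists (iota 0 4) | size J < 4].

(** Each list contains the whole subgroup, and each of its elements carries a correct word in the
    letters [J]. *)
Lemma parabolicP : all (fun J =>
  let P := parabolic J in let D := unzip2 P in
  [&& stable (step cell_table) J D, iota 0 11 \in D
    & all (fun c => all (mem J) c.1 && (image cell_table c.1 == c.2)) P])
  proper_subsets.
Proof. by vm_cast_no_check (erefl true). Qed.

Lemma parabolicI : all (fun J => all (fun K =>
    let D := unzip2 (parabolic [seq i <- J | i \in K]) in
    let DK := unzip2 (parabolic K) in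
    all (fun a => (a \in DK) ==> (a \in D)) (unzip2 (parabolic J)))
  proper_subsets) proper_subsets.
Proof. by vm_cast_no_check (erefl true). Qed.

Lemma cell_perm_ip : word_ip 4 cell_perm.
Proof.
move=> u v u4 v4 e.
pose J (w : seq nat) := [seq i <- iota 0 4 | i \in w].
have full w w' : all (gtn 4) w' -> (size (J w) < 4) = false -> {subset w' <= w}.
  move=> w'4 sz i /(allP w'4) i4.
  have /allP : all (fun i => i \in w) (iota 0 4).
    rewrite all_count eqn_leq count_size -size_filter leqNgt.
    exact: (negbT sz).
  by apply; rewrite mem_iota.
(* If one word uses all four letters, the other word is already in the common letters. *)
case szu : (size (J u) < 4); last by exists v; split=> //; apply: full szu.
case szv : (size (J v) < 4); last by exists u; split=> //; apply: full szv.
have Ju : J u \in proper_subsets by rewrite mem_filter szu filter_sublists.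
have Jv : J v \in proper_subsets by rewrite mem_filter szv filter_sublists.
have inD w : all (gtn 4) w -> J w \in proper_subsets ->
    image cell_table w \in unzip2 (parabolic (J w)).
  move=> w4 /(allP parabolicP)/and3P[sD i0 _].
  apply: (stable_run sD) => // i iw.
  by rewrite mem_filter iw mem_iota; apply: (allP w4 i iw).
have imE := image_eq (enum_uniq 'I_11) (size_enum_ord 11) models_cell_table cell_table_full.
have uv : image cell_table u = image cell_table v by apply/eqP; rewrite imE // e.
have M : [seq i <- J u | i \in J v] \in proper_subsets.
  have sz : size [seq i <- J u | i \in J v] < 4.
    by apply: leq_ltn_trans szu; rewrite size_filter count_size.
  by rewrite mem_filter sz -filter_predI filter_sublists.
(* The common image lies in both lists, hence in the list for the common letters, which supplies the
   word sought. *)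
have := allP (allP parabolicI _ Ju) _ Jv.
move/allP/(_ _ (inD u u4 Ju)); rewrite {1}uv inD //= => /mapP[[w a] wP /= ea].
have /and3P[_ _ /allP/(_ _ wP)/andP[/= /allP wM /eqP wa]] := allP parabolicP _ M.
have sub i : i \in w -> [/\ i \in u, i \in v & i < 4].
  move/wM; rewrite !inE !mem_filter mem_iota /=.
  by move=> /andP[/andP[iv _] /andP[iu i4]].
exists w; split=> [i /sub[]|i /sub[]|] //.
apply/eqP; rewrite -imE //; last by apply/allP=> i /sub[].
by rewrite wa ea.
Qed.

(** * The 11-cell as a string C-group *)

Definition cell_gens : 4.-tuple {perm 'I_11} :=
  [tuple cell_perm 0; cell_perm 1; cell_perm 2; cell_perm 3].

Definition eleven_cell : group_with_gens :=
  GroupWithGens [group of <<[set tnth cell_gens j | j in [set: 'I_4]]>>%g]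
    cell_gens.

Lemma gen_cell i : i < 4 -> gen eleven_cell i = cell_perm i.
Proof. by case: i => [|[|[|[|i]]]]. Qed.

Lemma gen_dual i : i < 4 -> gen (string_dual eleven_cell) i = cell_perm (3 - i).
Proof. by case: i => [|[|[|[|i]]]]. Qed.

Lemma gen_default (Gamma : group_with_gens) i : sgrank Gamma <= i -> gen Gamma i = 1%g.
Proof. by move=> ri; rewrite /gen nth_default ?size_tuple. Qed.

Lemma eq_cellular (H : groupType) (x y : nat -> H) :
  (forall i, i < 4 -> x i = y i) -> (forall i, 4 <= i -> x i = 1%g) ->
  cellular y /\ separated y -> cellular x /\ separated x.
Proof.
move=> xy x1 [[yI yR] yS]; split; last first.
  move=> w ww; rewrite (eq_eval xy) ?yS //.
  by apply: (allP cell_words_letters); apply: mem_behead.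
split=> [i|R RR]; last first.
  by rewrite (eq_eval xy) ?yR //; apply: (allP cell_relators_letters).
by have [i4|i4] := ltnP i 4; [rewrite xy | rewrite x1 // mulg1].
Qed.

Lemma gen_cell_cellular : cellular (gen eleven_cell) /\ separated (gen eleven_cell).
Proof. exact: eq_cellular gen_cell (@gen_default eleven_cell) cell_perm_cell. Qed.

Lemma gen_dual_cellular :
  cellular (gen (string_dual eleven_cell)) /\ separated (gen (string_dual eleven_cell)).
Proof.
exact: eq_cellular gen_dual (@gen_default (string_dual eleven_cell)) dual_perm_cell.
Qed.

Lemma letters_separated i : i < 4 -> [:: i] \in behead cell_words.
Proof. by case: i => [|[|[|[|i]]]]. Qed.

Lemma cellular_sggi (Gamma : group_with_gens) :
  gen_sub [set: 'I_(sgrank Gamma)] = grp Gamma -> sgrank Gamma = 4 ->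
  cellular (gen Gamma) -> separated (gen Gamma) -> is_sggi Gamma.
Proof.
move=> gG r4 cG pG; split=> // [i|i j].
  apply: nt_prime_order => //; rewrite -gen_rho ?expg2; first exact: cG.1.
  have i4 : i < 4 by rewrite -r4.
  by have := pG [:: val i] (letters_separated i4); rewrite /= mulg1.
rewrite -!gen_rho => ij.
have [_ _ [r02 r03 r13] _] := (cellular_relations (fun i i4 =>
  gen_default (Gamma := Gamma) (i := i) (leq_trans (eq_leq r4) i4))).1 cG.
have flip a b : ((gen Gamma a * gen Gamma b) ^+ 2 = 1 ->
    (gen Gamma b * gen Gamma a) ^+ 2 = 1)%g.
  move=> e; apply: (mulgI (gen Gamma a)).
  by rewrite mulg1 -[RHS]mul1g -e !expg2 !mulgA.
have := ltn_ord i; have := ltn_ord j; rewrite {2 4}r4.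
move: (nat_of_ord i) (nat_of_ord j) ij => {i j} a b.
by case: a => [|[|[|[|a]]]]; case: b => [|[|[|[|b]]]] // _ _ _; auto.
Qed.

Lemma gen_sub_dual (Gamma : group_with_gens) :
  gen_sub [set: 'I_(sgrank (string_dual Gamma))] =
  gen_sub [set: 'I_(sgrank Gamma)].
Proof.
rewrite /gen_sub; congr << _ >>%g.
have rhoE (j : 'I_(sgrank Gamma)) :
    @rho (string_dual Gamma) j = rho (rev_ord j).
  by rewrite -!gen_rho /gen nth_rev ?size_tuple.
apply/setP=> g; apply/imsetP/imsetP => [] [j _ ->]; exists (rev_ord j) => //.
by rewrite -[in LHS](rev_ordK j) -rhoE.
Qed.

Lemma gen_sub_cell : gen_sub [set: 'I_(sgrank eleven_cell)] = grp eleven_cell.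
Proof. by []. Qed.

Lemma cell_sggi : is_sggi eleven_cell.
Proof.
by have [c p] := gen_cell_cellular; apply: cellular_sggi gen_sub_cell _ c p.
Qed.

Lemma dual_sggi : is_sggi (string_dual eleven_cell).
Proof.
have [c p] := gen_dual_cellular.
apply: cellular_sggi c p => //.
by rewrite gen_sub_dual gen_sub_cell.
Qed.

Lemma cell_string_C : is_string_C_group eleven_cell.
Proof.
apply: word_ip_string_C cell_sggi _ => u v u4 v4.
rewrite !(eq_eval gen_cell) // => /(cell_perm_ip u4 v4)[w [wu wv ew]].
by exists w; split=> //; rewrite (eq_eval gen_cell) //; apply/allP=> i /wu /(allP u4).
Qed.

(** Each row moves 8 points, so it is a product of four transpositions. *)
Lemma cell_perm_even i : i < 4 -> cell_perm i \in ('Alt_('I_11))%g.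
Proof.
move=> i4; rewrite Alt_even (involution_parity (cell_permK i)).2.
have -> : #|[set x | cell_perm i x != x]| =
    count (fun v => nth 0 (nth [::] cell_rows i) v != v) (iota 0 11).
  rewrite -val_enum_ord count_map cardsE cardE /enum_mem size_filter -enumT.
  rewrite filter_predT; apply: eq_count => x.
  by rewrite /= unfold_in /= permE -val_eqE /= (row_funE _ i4).1.
by case: i i4 => [|[|[|[|i]]]].
Qed.

Lemma cell_words_transitive :
  all (fun v => lazy_has (fun w => nth 0 (image cell_table w) 0 == v) cell_words)
    (iota 0 11).
Proof. by vm_cast_no_check (erefl true). Qed.

Lemma cell_transitive_even : iso_transitive_even 11 (grp eleven_cell).
Proof.
exists (grp eleven_cell); split; last exact: isog_refl.
  rewrite gen_subG; apply/subsetP=> _ /imsetP[j _ ->].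
  by rewrite (tnth_nth 1%g) -[nth _ _ _]/(gen eleven_cell j) gen_cell // cell_perm_even.
apply/imsetP; exists ord0; rewrite ?inE //; apply/setP=> y; rewrite inE.
have : (y : nat) \in iota 0 11 by rewrite mem_iota /= ltn_ord.
move/(allP cell_words_transitive); rewrite lazy_hasE => /hasP[w wW /eqP ew].
have w4 := allP cell_words_letters w wW.
apply/esym/orbitP; exists (eval (gen eleven_cell) w); first exact: eval_grp gen_sub_cell w.
have [_ /(_ 0 isT)[_ e]] := image_eval models_cell_table cell_table_full w4.
rewrite /= apermE (eq_eval gen_cell) //.
have -> : ord0 = nth ord0 (enum 'I_11) 0 by apply: ord_inj; rewrite nth_enum_ord.
by rewrite -e ew nth_ord_enum.
Qed.

(** * Uniqueness and universal property *)

(** The generators are carried to permutations by the given isomorphism [f] and classified there;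
    injectivity of [f] brings the relations and the separation back. *)
Lemma string_C_cell (Delta : group_with_gens) :
  is_string_C_group Delta -> sgrank Delta \in [:: 4; 5] ->
  iso_transitive_even 11 (grp Delta) -> string_iso Delta eleven_cell.
Proof.
move=> sC r45 [H [HAlt Htr /isogP[f injf fH]]].
have [sg _] := sC; have [gG ord2 far2] := sg.
have gI := sggi_gen_inv sg; have xG := eval_grp gG.
have Gx i : gen Delta i \in grp Delta by have := xG [:: i]; rewrite /= mulg1.
pose s i := f (gen Delta i).
have sE w : eval s w = f (eval (gen Delta) w).
  by rewrite (morph_eval f w Gx).2.
have f1 w : eval s w = 1%g <-> eval (gen Delta) w = 1%g.
  rewrite sE; split=> [/eqP|->]; last exact: morph1.
  by rewrite morph_injm_eq1 // => /eqP.
have sI i : (s i * s i = 1)%g by rewrite -morphM // gI morph1.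
have sK i : involutive (s i) by move=> x; rewrite -permM sI perm1.
have sH w : eval s w \in H by rewrite sE -fH mem_morphim.
have [r4 [cI cR] pS] : [/\ sgrank Delta = 4, cellular s & separated s].
  apply: classification => // [i ir|i j ir jr ij x|A A0 As|].
  - split; last by apply: (subsetP HAlt); have := sH [:: i]; rewrite /= mulg1.
    rewrite morph_injm_eq1 //; apply/negP => /eqP e.
    by have := ord2 (Ordinal ir); rewrite -gen_rho /= e order1.
  - have e : (s i * s j * (s i * s j) = 1)%g.
      have := far2 (Ordinal ir) (Ordinal jr) ij; rewrite -!gen_rho /= expg2 => e.
      by rewrite -!morphM ?groupM // e morph1.
    rewrite -!permM; congr (fun_of_perm _ x).
    apply: (mulgI (s i)); apply: (mulIg (s j)).
    by rewrite !mulgA sI mul1g sI -e !mulgA.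
  (* Any point is the image of [a] under some element of [H], which is a word in the [s i], and [A]
     is closed under each letter. *)
  - have [a aA] := set0Pn _ A0; apply/setP=> y; rewrite inE.
    have [h] := atransP2 Htr (in_setT a) (in_setT y).
    rewrite -fH => /morphimP[g Gg _ ->] ->; rewrite /= apermE.
    have [w wr <-] := grp_eval gG Gg; rewrite -sE.
    elim: w wr a aA => [|i w IHw] /= => [_ a aA|/andP[ir wr] a aA].
      by rewrite perm1.
    by rewrite permM IHw // As.
  - move=> u v ur vr; rewrite !sE => /(injmP injf) e.
    have [|w [wu wv ew]] := string_C_word_ip sC ur vr.
      by apply: e; apply: xG.
    by exists w; split=> //; rewrite !sE ew.
have cD : cellular (gen Delta).
  by split=> // R RR; apply/f1; apply: cR.
have pD : separated (gen Delta).
  by move=> w ww; apply: contra_neq (pS w ww) => e; apply/f1.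
have [cC pC] := gen_cell_cellular.
exact: cell_string_iso sg cell_sggi r4 _ cD pD cC pC.
Qed.

(** A word trivial in the 11-cell traces back to the empty word in the table, so it is trivial in
    every group satisfying the relations, and [extend_words] applies. *)
Lemma cell_is_eleven_cell : is_eleven_cell eleven_cell.
Proof.
exists (cell_perm 0), (cell_perm 1), (cell_perm 2), (cell_perm 3).
have [cC pC] := gen_cell_cellular.
split=> //.
  exact: (cellular_relations (@gen_default eleven_cell)).1 cC.
move=> H x0 x1 x2 x3 rel.
pose x i := nth 1%g [:: x0; x1; x2; x3] i.
have cx : cellular x.
  by apply/cellular_relations => // i i4; rewrite /x nth_default.
have [|||phi [phiM phiE]] := extend_words gen_sub_cell (y := x) _ _ _.
- exact: cC.1.
- exact: cx.1.
- move=> w w4 /(eval_cell1 cC pC w4) wk.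
  have [k [_ wk' ->]] := eval_cell cx w4.
  by move: wk'; rewrite wk => -[<-].
exists phi; split=> //.
by split; [have := phiE [:: 0] isT | have := phiE [:: 1] isT
  | have := phiE [:: 2] isT | have := phiE [:: 3] isT]; rewrite /= !mulg1.
Qed.

Theorem theorem8p8 :
  exists Gamma : group_with_gens,
    [/\ is_string_C_group Gamma,
        sgrank Gamma \in [:: 4; 5],
        iso_transitive_even 11 (grp Gamma)
      & forall Delta : group_with_gens,
          is_string_C_group Delta ->
          sgrank Delta \in [:: 4; 5] ->
          iso_transitive_even 11 (grp Delta) ->
          string_iso Delta Gamma] /\
    [/\ sgrank Gamma = 4, is_eleven_cell Gamma & self_dual Gamma].
Proof.
exists eleven_cell; split; split=> //.
- exact: cell_string_C.
- exact: cell_transitive_even.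
- exact: string_C_cell.
- exact: cell_is_eleven_cell.
have [cC pC] := gen_cell_cellular; have [cD pD] := gen_dual_cellular.
exact: cell_string_iso cell_sggi dual_sggi _ _ cC pC cD pD.
Qed.
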